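(* Fix any $\gamma>0$. Consider the chain precedence graph $g\to r\to a\to b$ with the naive parent penalty $$V_{\mathrm{par}}(x)=x_r(1-x_g)+x_a(1-x_r)+x_b(1-x_a),\qquad x=(x_g,x_r,x_a,x_b).$$ Define $\hat f(x):=-w^\top x+\gamma V_{\mathrm{par}}(x)$ over $[0,1]^4$ with weights $w_g=w_r=-1$ and $w_a=w_b=1$. Then the infeasible binary point $x^\star=(0,0,1,1)$ is a strict local minimizer of $\hat f$ over $[0,1]^4$.
   Context: An arrow $p\to c$ is the precedence constraint $x_c\le x_p$ (block $p$ must be extracted before block $c$); a binary point is infeasible if it violates at least one of these constraints. A point $x^\star\in[0,1]^4$ is a strict local minimizer of $\hat f$ over $[0,1]^4$ if $\hat f(x)>\hat f(x^\star)$ for all $x\in[0,1]^4\setminus\{x^\star\}$ in some neighborhood of $x^\star$. *)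

(* Defs.v *)
From HB Require Import structures.
From mathcomp Require Import all_boot all_order all_algebra.
From mathcomp Require Import all_classical all_reals all_analysis.

Set Implicit Arguments.
Unset Strict Implicit.
Unset Printing Implicit Defensive.

Import Order.TTheory GRing.Theory Num.Theory.
Import numFieldNormedType.Exports.

Local Open Scope classical_set_scope.
Local Open Scope ring_scope.

(* Blocks are coordinate indices, in the order x = (x_g, x_r, x_a, x_b). *)
Definition blk_g : 'I_4 := @Ordinal 4 0 isT.
Definition blk_r : 'I_4 := @Ordinal 4 1 isT.
Definition blk_a : 'I_4 := @Ordinal 4 2 isT.
Definition blk_b : 'I_4 := @Ordinal 4 3 isT.

(* A pair (p, c) is the arrow p -> c: block p must be extracted before c. *)
Definition chain_arrows : seq ('I_4 * 'I_4) :=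
  [:: (blk_g, blk_r); (blk_r, blk_a); (blk_a, blk_b)].

Section Precedence.
Variables (R : realType) (n : nat).
Implicit Types (x : 'cV[R]_n) (arrows : seq ('I_n * 'I_n)).

Definition binary x : Prop := forall i, x i 0 = 0 \/ x i 0 = 1.

Definition infeasible arrows x : Prop :=
  exists2 e : 'I_n * 'I_n, e \in arrows & ~ (x e.2 0 <= x e.1 0).

Definition unit_cube : set 'cV[R]_n :=
  [set x | forall i, 0 <= x i 0 <= 1].

End Precedence.
Arguments unit_cube : clear implicits.

Definition strict_local_minimizer (R : realType) (T : topologicalType)
    (f : T -> R) (A : set T) (x : T) : Prop :=
  A x /\ \forall y \near x, A y -> y <> x -> f y > f x.

Section Chain.
Variable R : realType.
Implicit Type x : 'cV[R]_4.

Definition col4 (c_g c_r c_a c_b : R) : 'cV[R]_4 :=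
  \col_i [:: c_g; c_r; c_a; c_b]`_i.

Definition V_par x : R :=
  x blk_r 0 * (1 - x blk_g 0)
  + x blk_a 0 * (1 - x blk_r 0)
  + x blk_b 0 * (1 - x blk_a 0).

Definition weight : 'cV[R]_4 := col4 (-1) (-1) 1 1.

Definition fhat (gamma : R) x : R :=
  - (weight^T *m x) 0 0 + gamma * V_par x.

Definition xstar : 'cV[R]_4 := col4 0 0 1 1.

End Chain.
Arguments weight : clear implicits.
Arguments xstar : clear implicits.

(* Main.v *)
(** With [A = 1 - a] and [B = 1 - b], the gap is
    [fhat x - fhat xstar = g (1 - gamma r) + B (1 - gamma A) + r + A + gamma A r],
    a sum of nonnegative terms on the cube as soon as [gamma r] and [gamma A]
    are less than 1, and then zero only if [g = r = A = B = 0]. *)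

Require Import Defs.
From mathcomp Require Import all_boot all_order all_algebra.
From mathcomp Require Import all_classical all_reals all_analysis.
From mathcomp Require Import ring lra.

Import Order.TTheory GRing.Theory Num.Theory.
Import numFieldNormedType.Exports.

Local Open Scope ring_scope.

(** Lets formulas proved for explicit coordinates apply to an arbitrary point of a neighbourhood. *)
Lemma col4P (R : realType) (x : 'cV[R]_4) :
  x = col4 (x blk_g 0) (x blk_r 0) (x blk_a 0) (x blk_b 0).
Proof.
apply/colP => -[[|[|[|[|//]]]] lti]; rewrite mxE /=;
  by congr (x _ _); apply: val_inj.
Qed.

Lemma fhat_col4 (R : realType) (gamma g r a b : R) :
  fhat gamma (col4 g r a b) =
  g + r - a - b + gamma * (r * (1 - g) + a * (1 - r) + b * (1 - a)).
Proof.
rewrite /fhat /V_par /weight !mxE /= !big_ord_recl big_ord0 !mxE /=; ring.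
Qed.

Lemma fhat_gap (R : realType) (gamma g r a b : R) :
  fhat gamma (col4 g r a b) - fhat gamma (xstar R) =
  g * (1 - gamma * r) + (1 - b) * (1 - gamma * (1 - a))
  + r + (1 - a) + gamma * ((1 - a) * r).
Proof. rewrite /xstar !fhat_col4; ring. Qed.

Lemma fhat_gap_gt0 (R : realType) (gamma g r a b : R) :
  0 < gamma -> 0 <= g -> 0 <= r -> a <= 1 -> b <= 1 ->
  gamma * r < 1 -> gamma * (1 - a) < 1 ->
  col4 g r a b <> xstar R ->
  fhat gamma (xstar R) < fhat gamma (col4 g r a b).
Proof.
move=> gamma0 g0 r0 a1 b1 r_small a_small x_neq.
rewrite ltNge -subr_le0 fhat_gap; apply/negP => gap_le0; apply: x_neq.
(* Once the signs of the three products are known, [lra] can treat them as atoms: a nonpositive gap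
   then forces the nonnegative terms [r] and [1 - a] to vanish. *)
have gr0 : 0 <= g * (1 - gamma * r) by apply: mulr_ge0; lra.
have ab0 : 0 <= (1 - b) * (1 - gamma * (1 - a)) by apply: mulr_ge0; lra.
have ar0 : 0 <= gamma * ((1 - a) * r) by rewrite !mulr_ge0//; lra.
have r_eq : r = 0 by lra.
have a_eq : a = 1 by lra.
(* At [r = 0] and [a = 1] both factors containing [gamma] become 1, so the gap collapses to the
   linear expression [g + (1 - b)]. *)
subst r a; rewrite !(subrr, mulr0, subr0, mulr1) in gr0 ab0 gap_le0.
by have [-> ->] : g = 0 /\ b = 1 by split; lra.
Qed.

Theorem lemma3p3 (R : realType) (gamma : R) (gamma_gt0 : 0 < gamma) :
  [/\ binary (xstar R),
      infeasible chain_arrows (xstar R) &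
      strict_local_minimizer (fhat gamma) (unit_cube R 4) (xstar R)].
Proof.
have xstar_bin : binary (xstar R).
  by case=> [[|[|[|[|//]]]] lti]; rewrite mxE /=; [left|left|right|right].
split=> //.
  (* The only violated arrow: a is extracted while its parent r is not. *)
  exists (blk_r, blk_a); first by rewrite !inE eqxx orbT.
  by rewrite !mxE /= ler10.
split=> [i|].
  by case: (xstar_bin i) => ->; rewrite lexx ler01.
(* Balls are coordinatewise, so this radius gives [|r| < gamma^-1] and [|1 - a| < gamma^-1], which
   are the two smallness conditions after multiplying by [gamma]. *)
apply/nbhs_ballP; exists gamma^-1; first by rewrite /= invr_gt0.
move=> y [_ y_near] y_cube.
rewrite (col4P _ y) => y_neq.
have /andP[g0 _] := y_cube blk_g.
have /andP[r0 _] := y_cube blk_r.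
have /andP[_ a1] := y_cube blk_a.
have /andP[_ b1] := y_cube blk_b.
have := y_near blk_r 0; have := y_near blk_a 0.
rewrite /ball /= !mxE /= sub0r normrN => a_near r_near.
apply: fhat_gap_gt0 => //; rewrite mulrC -ltr_pdivlMr// div1r;
  exact: le_lt_trans (ler_norm _) _.
Qed.
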